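(* Let $\mathcal{F}$ and $\mathcal{F}'$ be families of finite graphs up to isomorphism with $\mathcal{F}=S(\mathcal{F}')$. Then $\mathcal{F}$ has NIP if and only if $\mathcal{F}'$ has NIP. In particular, if $\mathcal{F}$ is a family of finite graphs closed under substitutions and under induced subgraphs and $\mathcal{P}$ is the family of all prime graphs in $\mathcal{F}$, then $\mathcal{F}$ has NIP if and only if $\mathcal{P}$ has NIP.
   Context: For a graph $G$ with at least one vertex, $\mathrm{VC}(G)$ is the largest size of $U\subseteq V(G)$ such that for every $A\subseteq U$ there is $v\in V(G)$ with $N_G(v)\cap U=A$ ($N_G(v)$ the neighbourhood of $v$); $\mathrm{VC}(K_0)=0$. A family $\mathcal{F}$ has NIP if $\sup\{\mathrm{VC}(G):G\in\mathcal{F}\}<\infty$. The substitution $F_1^{v\to F_2}$ replaces vertex $v$ of $F_1$ by a copy of $F_2$, each of whose vertices is adjacent exactly to the neighbours of $v$ in $F_1$. $S(\mathcal{F}')$ is the smallest family containing $\mathcal{F}'$ closed under substitutions. A graph $F$ is prime if it is not of the form $F_1^{v\to F_2}$ with $|F_1|,|F_2|<|F|$. *)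

(* Defs.v *)
From mathcomp Require Import all_boot.

Set Implicit Arguments.
Unset Strict Implicit.
Unset Printing Implicit Defensive.

(* The empty vertex type is allowed: K_0 is a graph. *)
Record sgraph := SGraph {
  vertex :> finType;
  adj : rel vertex;
  adj_sym : symmetric adj;
  adj_irrefl : irreflexive adj
}.

Definition giso (G H : sgraph) : Prop :=
  exists2 f : G -> H, bijective f & {mono f : x y / adj x y}.

Lemma giso_sym (G H : sgraph) : giso G H -> giso H G.
Proof.
case=> f [g fK gK] fM; exists g; first by exists f.
by move=> x y; rewrite -fM !gK.
Qed.

Lemma giso_trans (G H K : sgraph) : giso G H -> giso H K -> giso G K.
Proof.
case=> f f_bij fM [g g_bij gM]; exists (g \o f); first exact: bij_comp.
by move=> x y; rewrite /= gM fM.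
Qed.

Lemma card_giso (G H : sgraph) : giso G H -> #|G| = #|H|.
Proof. by case=> f f_bij _; exact: bij_eq_card f_bij. Qed.

Definition nbhd (G : sgraph) (v : G) : {set G} := [set w | adj v w].

Definition shattered (G : sgraph) (U : {set G}) : bool :=
  [forall A : {set G}, (A \subset U) ==> [exists v : G, nbhd v :&: U == A]].

(* If G has a vertex then set0 is shattered; if G is empty then no set is
   shattered and the maximum is 0, which is the convention VC(K_0) = 0. *)
Definition VC (G : sgraph) : nat := \max_(U : {set G} | shattered U) #|U|.

Section Substitution.
Variables (F1 : sgraph) (v : F1) (F2 : sgraph).

Definition subst_vertex : finType := ({x : F1 | x != v} + F2)%type.

Definition subst_adj : rel subst_vertex := fun a b =>
  match a, b with
  | inl x, inl y => adj (val x) (val y)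
  | inl x, inr _ => adj (val x) v
  | inr _, inl y => adj v (val y)
  | inr x, inr y => adj x y
  end.

Lemma subst_adj_sym : symmetric subst_adj.
Proof. by case=> [x|x] [y|y] /=; rewrite adj_sym. Qed.

Lemma subst_adj_irrefl : irreflexive subst_adj.
Proof. by case=> x /=; rewrite adj_irrefl. Qed.

Definition substitution : sgraph := SGraph subst_adj_sym subst_adj_irrefl.

End Substitution.

Section Induced.
Variables (G : sgraph) (A : {set G}).

Definition induced_adj : rel {x : G | x \in A} :=
  fun x y => adj (val x) (val y).

Lemma induced_adj_sym : symmetric induced_adj.
Proof. by move=> x y; rewrite /induced_adj adj_sym. Qed.

Lemma induced_adj_irrefl : irreflexive induced_adj.
Proof. by move=> x; rewrite /induced_adj adj_irrefl. Qed.

Definition induced : sgraph := SGraph induced_adj_sym induced_adj_irrefl.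

End Induced.

Definition prime_graph (F : sgraph) : Prop :=
  ~ exists (F1 : sgraph) (v : F1) (F2 : sgraph),
      [/\ #|F1| < #|F|, #|F2| < #|F| & giso F (substitution v F2)].

(* A family of finite graphs up to isomorphism is an isomorphism-invariant
   class of finite graphs. *)
Record graph_family := Family {
  mem_family :> sgraph -> Prop;
  family_giso : forall G H : sgraph, giso G H -> mem_family G -> mem_family H
}.

Definition subfamily (E F : graph_family) : Prop := forall G : sgraph, E G -> F G.

Definition eqfamily (E F : graph_family) : Prop := forall G : sgraph, E G <-> F G.

Definition subst_closed (F : graph_family) : Prop :=
  forall (F1 : sgraph) (v : F1) (F2 : sgraph), F F1 -> F F2 -> F (substitution v F2).

Definition induced_closed (F : graph_family) : Prop :=
  forall (G : sgraph) (A : {set G}), F G -> F (induced A).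

Definition in_subst_closure (F' : graph_family) (G : sgraph) : Prop :=
  forall E : graph_family, subfamily F' E -> subst_closed E -> E G.

Lemma in_subst_closure_giso (F' : graph_family) (G H : sgraph) :
  giso G H -> in_subst_closure F' G -> in_subst_closure F' H.
Proof.
by move=> GH SG E sub clo; apply: (family_giso GH); exact: SG.
Qed.

Definition subst_closure (F' : graph_family) : graph_family :=
  Family (@in_subst_closure_giso F').

Lemma subfamily_subst_closure (F' : graph_family) : subfamily F' (subst_closure F').
Proof. by move=> G F'G E sub _; exact: sub. Qed.

Lemma subst_closure_closed (F' : graph_family) : subst_closed (subst_closure F').
Proof.
by move=> F1 v F2 S1 S2 E sub clo; apply: (clo); [exact: S1|exact: S2].
Qed.

Lemma subst_closure_min (F' E : graph_family) :
  subfamily F' E -> subst_closed E -> subfamily (subst_closure F') E.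
Proof. by move=> sub clo G; apply. Qed.

Lemma prime_in_giso (F : graph_family) (G H : sgraph) :
  giso G H -> F G /\ prime_graph G -> F H /\ prime_graph H.
Proof.
move=> GH [FG prG]; split; first exact: family_giso FG.
case=> F1 [v [F2 [lt1 lt2 iso]]]; apply: prG; exists F1, v, F2.
by rewrite (card_giso GH); split=> //; exact: giso_trans iso.
Qed.

Definition primes_of (F : graph_family) : graph_family := Family (@prime_in_giso F).

Definition NIP (F : graph_family) : Prop :=
  exists n : nat, forall G : sgraph, F G -> VC G <= n.

(* Main.v *)
Require Import Defs.
From mathcomp Require Import all_boot.
From mathcomp Require Import zify.

Set Implicit Arguments.
Unset Strict Implicit.
Unset Printing Implicit Defensive.

(* VC itself can grow under substitution: when a shattered set U meets the copy
   of F2 in one vertex, the projection of U to F1 may fail to cut out the closed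
   neighbourhood of v, and when U lies inside the copy of F2, the empty set and
   U may be cut out only by vertices outside it. A set is weakly shattered if
   these exceptional traces (the empty set, the whole set, and traces of closed
   neighbourhoods of its own vertices) are allowed too. The largest size wVC of
   a weakly shattered set satisfies wVC(F1^{v -> F2}) <= max(wVC F1, wVC F2),
   and VC <= wVC <= 2 VC + 7 by pigeonhole. For a family closed under induced
   subgraphs, a graph that is not prime decomposes into two smaller members, so
   the bound on wVC for primes extends to the family by induction. *)

(** * Weak traces and weakly shattered sets *)

Definition closed_nbhd (G : sgraph) (v : G) : {set G} := v |: nbhd v.

Definition weak_trace (G : sgraph) (U A : {set G}) : bool :=
  [|| A == set0, A == U, [exists y : G, nbhd y :&: U == A]
    | [exists y in U, closed_nbhd y :&: U == A]].

Definition weakly_shattered (G : sgraph) (U : {set G}) : bool :=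
  [forall A : {set G}, (A \subset U) ==> weak_trace U A].

Definition wVC (G : sgraph) : nat :=
  \max_(U : {set G} | weakly_shattered U) #|U|.

Variant weak_trace_spec (G : sgraph) (U A : {set G}) : Prop :=
  | WeakTrace0 of A = set0
  | WeakTraceT of A = U
  | WeakTraceOpen y of {in U, forall b, (b \in A) = adj y b}
  | WeakTraceClosed y of y \in U
      & {in U, forall b, (b \in A) = (b == y) || adj y b}.

Lemma weak_traceP (G : sgraph) (U A : {set G}) :
  A \subset U -> reflect (weak_trace_spec U A) (weak_trace U A).
Proof.
move=> /subsetP AU.
have out (b : G) : b \notin U -> false = (b \in A).
  by move=> bU; apply/esym/negP=> /AU; apply/negP.
apply: (iffP or4P) => [[/eqP|/eqP|/existsP[y /eqP yA]
    |/existsP[y /andP[yU /eqP yA]]]|].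
- exact: WeakTrace0.
- exact: WeakTraceT.
- by apply: (WeakTraceOpen (y := y)) => b bU; rewrite -yA !inE bU andbT.
- by apply: (WeakTraceClosed yU) => b bU; rewrite -yA !inE bU andbT.
case=> [->|->|y yA|y yU yA]; first exact: Or41; first exact: Or42.
- apply: Or43; apply/existsP; exists y; apply/eqP/setP=> b; rewrite !inE.
  by case: (boolP (b \in U)) => [/yA->|/out]; rewrite ?andbT ?andbF.
- apply: Or44; apply/existsP; exists y; rewrite yU; apply/eqP/setP=> b; rewrite !inE.
  by case: (boolP (b \in U)) => [/yA->|/out]; rewrite ?andbT ?andbF.
Qed.

Lemma weakly_shatteredP (G : sgraph) (U : {set G}) :
  reflect (forall A : {set G}, A \subset U -> weak_trace_spec U A)
          (weakly_shattered U).
Proof.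
apply: (iffP forallP) => [wU A AU|wU A].
  by apply/weak_traceP=> //; exact: (implyP (wU A)).
by apply/implyP=> AU; apply/weak_traceP=> //; exact: wU.
Qed.

(** * Comparison of [VC] with [wVC] *)

Lemma leq_wVC (G : sgraph) (U : {set G}) : weakly_shattered U -> #|U| <= wVC G.
Proof. by move=> wU; rewrite /wVC (bigD1 U) //= leq_maxl. Qed.

Lemma leq_VC (G : sgraph) (U : {set G}) : shattered U -> #|U| <= VC G.
Proof. by move=> sU; rewrite /VC (bigD1 U) //= leq_maxl. Qed.

Lemma shattered_weakly (G : sgraph) (U : {set G}) :
  shattered U -> weakly_shattered U.
Proof.
move=> /forallP sU; apply/forallP=> A; apply/implyP=> AU.
by apply/or4P/Or43; exact: (implyP (sU A)).
Qed.

Lemma VC_le_wVC (G : sgraph) : VC G <= wVC G.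
Proof. by apply/bigmax_leqP=> U /shattered_weakly /leq_wVC. Qed.

(* At most [#|U| + 2] subsets of a weakly shattered [U] are not traces of open
   neighbourhoods, so a subset of [V] has too many extensions to [U] for all
   of them to be missed. *)
Lemma shattered_sub_weakly (G : sgraph) (U V : {set G}) :
  weakly_shattered U -> V \subset U -> #|U| + 2 < 2 ^ #|U :\: V| -> shattered V.
Proof.
move=> /forallP wU VU lt; apply/forallP=> A; apply/implyP=> AV.
apply: contraT => /existsPn noA.
pose M := set0 |: (U |: [set closed_nbhd y :&: U | y in U]).
pose X := [set A :|: B | B in powerset (U :\: V)].
have cM : #|M| <= #|U| + 2.
  have cI : #|[set closed_nbhd y :&: U | y in U]| <= #|U| := leq_imset_card _ _.
  rewrite !cardsU1 addnA addnC leq_add //.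
  by case: (_ \notin _); case: (_ \notin _).
have cX : #|X| = 2 ^ #|U :\: V|.
  rewrite card_in_imset ?card_powerset // => B C; rewrite !inE => BD CD eqBC.
  have trace (D : {set G}) : D \subset U :\: V -> D = (A :|: D) :\: V.
    rewrite subsetD => /andP[_ dis].
    rewrite setDUl (eqP (_ : A :\: V == set0)) ?setD_eq0 // set0U.
    exact/esym/setDidPl.
  by rewrite (trace _ BD) (trace _ CD) eqBC.
have XM : X \subset M.
  apply/subsetP=> _ /imsetP[B /[!inE] BD ->].
  have BU : B \subset U by apply: subset_trans BD (subsetDl _ _).
  have ABU : A :|: B \subset U by rewrite subUset BU (subset_trans AV VU).
  case/or4P: (implyP (wU _) ABU) => [->//|->|/existsP[y /eqP yA]
    |/existsP[y /andP[yU yA]]].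
  - by rewrite orbT.
  (* Since [B] misses [V], the vertex [y] would cut out [A] from [V]. *)
  - case/eqP: (noA y); rewrite -(setIidPr VU) setIA yA setIUl (setIidPl AV).
    suff -> : B :&: V = set0 by rewrite setU0.
    by apply/eqP; rewrite setI_eq0; move: BD; rewrite subsetD => /andP[].
  - by rewrite -(eqP yA) (imset_f (fun y => closed_nbhd y :&: U) yU) !orbT.
by have := subset_leq_card XM; rewrite cX; lia.
Qed.

Lemma exists_subset_card (T : finType) (U : {set T}) (k : nat) :
  k <= #|U| -> exists2 V : {set T}, V \subset U & #|V| = k.
Proof.
move=> /card_geqP[s [us <- sU]]; exists [set x in s].
  by apply/subsetP=> x; rewrite inE; exact: sU.
by rewrite cardsE; apply/card_uniqP.
Qed.

Lemma wVC_le (G : sgraph) : wVC G <= (VC G).*2 + 7.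
Proof.
(* Keep the larger half of [U] as [V] and let h = [#|U|./2]. Then [#|U| + 2] is at most 2h + 3,
   which is below [2 ^ h] exactly from h = 4 on, that is, once [#|U|] exceeds 7. *)
apply/bigmax_leqP=> U wU; case: (leqP #|U| 7) => [|U8]; first lia.
have /exists_subset_card[V VU cV] : #|U| - #|U|./2 <= #|U| by rewrite leq_subr.
have cD : #|U :\: V| = #|U|./2 by rewrite cardsD (setIidPr VU) cV; lia.
have /leq_VC : shattered V; last by rewrite cV; lia.
apply: shattered_sub_weakly wU VU _; rewrite cD.
have exp h : 4 <= h -> h.*2 + 3 < 2 ^ h.
  elim: h => // h IH; rewrite leq_eqVlt => /orP[/eqP<-//|/IH].
  by rewrite expnS; lia.
by have := exp #|U|./2; lia.
Qed.

Lemma wVC_giso (G H : sgraph) : giso G H -> wVC G <= wVC H.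
Proof.
case=> f f_bij fM; have [g fK gK] := f_bij; have fI := bij_inj f_bij.
apply/bigmax_leqP=> U /weakly_shatteredP wU.
rewrite -(card_imset _ fI) leq_wVC //; apply/weakly_shatteredP=> A AU.
have mem (B : {set G}) b : (b \in f @: B) = (g b \in B).
  by rewrite -{1}(gK b) mem_imset.
have sub : f @^-1: A \subset U.
  by apply/subsetP=> x; rewrite inE => /(subsetP AU); rewrite mem_imset.
have eqA : A = f @: (f @^-1: A) by apply/setP=> b; rewrite mem inE gK.
case: (wU _ sub) => [A0|AT|y yA|y yU yA].
- by apply: WeakTrace0; rewrite eqA A0 imset0.
- by apply: WeakTraceT; rewrite eqA AT.
- apply: (WeakTraceOpen (y := f y)) => b; rewrite mem => /yA.
  by rewrite inE gK -fM gK.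
- apply: (WeakTraceClosed (y := f y)); first by rewrite mem_imset.
  by move=> b; rewrite mem => /yA; rewrite inE gK -fM gK -(inj_eq fI) gK.
Qed.

(** * Behaviour of [wVC] under substitution *)

Section WeakSubstitution.
Variables (F1 : sgraph) (v : F1) (F2 : sgraph).
Local Notation S := (substitution v F2).

Definition subst_proj (a : S) : F1 :=
  match a with inl x => val x | inr _ => v end.

Lemma adj_subst_proj (x : {x : F1 | x != v}) (b : S) :
  adj (inl x : S) b = adj (val x) (subst_proj b).
Proof. by case: b. Qed.

Lemma weakly_shattered_proj (U : {set S}) :
  {in U &, injective subst_proj} ->
  weakly_shattered U -> weakly_shattered (subst_proj @: U).
Proof.
move=> pI /weakly_shatteredP wU; apply/weakly_shatteredP=> A /subsetP AU.
have sub : U :&: subst_proj @^-1: A \subset U := subsetIl _ _.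
case: (wU _ sub) => [A0|AT|[y|y] yA|y yU yA].
- apply: WeakTrace0; apply/setP=> b; rewrite inE; apply/negP=> bA.
  case/imsetP: (AU b bA) => a aU eb.
  by move/setP: A0 => /(_ a); rewrite !inE aU -eb bA.
- apply: WeakTraceT; apply/eqP; rewrite eqEsubset; apply/andP; split.
    by apply/subsetP.
  by apply/subsetP=> _ /imsetP[a aU ->]; move: aU; rewrite -{1}AT !inE => /andP[].
- apply: (WeakTraceOpen (y := val y)) => _ /imsetP[b bU ->].
  by have := yA b bU; rewrite !inE bU adj_subst_proj.
(* A vertex [y] of the copy sees the neighbours of [v] and, by injectivity, at most one further
   member [b] of [U], which projects to [v]. Its trace projects to that of the closed neighbourhood
   of [v] if [b] exists, and of the open one otherwise. *)
- case: (boolP [exists b in U, (subst_proj b == v) && adj (inr y : S) b]).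
  + case/existsP=> b /and3P[bU /eqP pb yb].
    apply: (WeakTraceClosed (y := v)).
      by apply/imsetP; exists b; rewrite ?pb.
    move=> _ /imsetP[c cU ->]; have := yA c cU; rewrite !inE cU /= => ->.
    case: eqP => [pc|]; first by rewrite (pI c b) ?pc.
    by case: (c).
  + move=> /existsPn nb; apply: (WeakTraceOpen (y := v)) => _ /imsetP[c cU ->].
    have := yA c cU; rewrite !inE cU /= => ->; have := nb c; rewrite cU /=.
    by case: c {cU} => [//|c] /=; rewrite eqxx adj_irrefl /=; apply: negbTE.
- apply: (WeakTraceClosed (y := subst_proj y)); first exact: imset_f.
  move=> _ /imsetP[b bU ->]; have := yA b bU; rewrite !inE bU /= => ->.
  rewrite (inj_in_eq pI) //; case: eqP => //= neq.
  case: y yU {yA} neq => [y|y] yU neq; first by case: b bU neq.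
  by case: b bU neq => [//|b] bU []; exact: pI.
Qed.

(** A vertex outside the copy of [F2] sees all of the copy or none of it, so only a vertex of the
    copy can separate [x] from [y], and all of those treat [z] as [v] does. *)
Lemma weak_trace_separating (U A : {set S}) x y z :
  weak_trace_spec U A -> inr x \in U -> inr y \in U -> inl z \in U ->
  inr x \in A -> inr y \notin A -> (inl z \in A) = adj v (val z).
Proof.
move=> tr xU yU zU xA yA; case: tr => [A0|AT|[w|w] wA|[w|w] wU wA].
- by rewrite A0 inE in xA.
- by rewrite AT yU in yA.
- by move: xA yA; rewrite !wA //= => ->.
- by rewrite wA.
- by move: xA yA; rewrite !wA //= => ->.
- by rewrite wA.
Qed.

(* A vertex of [F1] in [U] could not be put in or out of a trace that
   separates [x] from [y], so [U] lies inside the copy of [F2]. *)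
Lemma weakly_shattered_inr (U : {set S}) (x y : F2) :
  weakly_shattered U -> x != y -> inr x \in U -> inr y \in U ->
  exists2 U2 : {set F2}, weakly_shattered U2 & #|U2| = #|U|.
Proof.
move=> /weakly_shatteredP wU xy xU yU.
have noinl z : inl z \notin U.
  apply/negP=> zU.
  have s1 : [set (inr x : S)] \subset U by rewrite sub1set.
  have s2 : [set (inr x : S); inl z] \subset U by rewrite subUset !sub1set xU.
  have nyx : ((inr y : S) == inr x) = false.
    by apply/eqP=> -[/eqP]; rewrite eq_sym (negbTE xy).
  have := weak_trace_separating (wU _ s1) xU yU zU.
  have := weak_trace_separating (wU _ s2) xU yU zU.
  by rewrite !inE nyx !eqxx /= => /(_ isT isT) <- /(_ isT isT).
have inrI : injective (inr : F2 -> S) by move=> a b [].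
pose U2 := [set a : F2 | inr a \in U].
have eqU : U = inr @: U2.
  apply/setP=> -[z|a]; last by rewrite mem_imset // inE.
  by rewrite (negbTE (noinl z)); apply/esym/imsetP=> -[].
exists U2; last by rewrite eqU card_imset.
apply/weakly_shatteredP=> A AU.
have sub : inr @: A \subset U by rewrite eqU imsetS.
have mem (B : {set F2}) b : ((inr b : S) \in inr @: B) = (b \in B) by exact: mem_imset.
case: (wU _ sub) => [A0|AT|[w|w] wA|[w|w] wU2 wA].
- by apply: WeakTrace0; apply/setP=> b; rewrite -mem A0 !inE.
- by apply: WeakTraceT; apply/setP=> b; rewrite -mem AT inE.
- case wv : (adj (val w) v).
  + apply: WeakTraceT; apply/setP=> b; apply/idP/idP; first exact: (subsetP AU).
    by rewrite inE => /wA; rewrite mem => ->.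
  + apply: WeakTrace0; apply/setP=> b; rewrite inE; apply/negP=> bA.
    by have := subsetP AU _ bA; rewrite inE => /wA; rewrite mem bA /= wv.
- by apply: (WeakTraceOpen (y := w)) => b; rewrite inE => /wA; rewrite mem.
- by rewrite (negbTE (noinl w)) in wU2.
- apply: (WeakTraceClosed (y := w)); first by rewrite inE.
  by move=> b; rewrite inE => /wA; rewrite mem (inj_eq inrI).
Qed.

Lemma wVC_substitution : wVC S <= maxn (wVC F1) (wVC F2).
Proof.
apply/bigmax_leqP=> U wU; rewrite leq_max.
(* Two members in the copy force [U] into it, giving the bound [wVC F2]; with at most one, the
   projection to [F1] is injective on [U]. *)
case: (boolP [exists x : F2, exists y : F2,
                [&& x != y, inr x \in U & inr y \in U]]).
  case/existsP=> x /existsP[y /and3P[xy xU yU]].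
  have [U2 wU2 <-] := weakly_shattered_inr wU xy xU yU.
  by rewrite (leq_wVC wU2) orbT.
move=> /existsPn one.
have pI : {in U &, injective subst_proj}.
  move=> [x|x] [y|y] xU yU //= e.
  - by congr inl; exact: val_inj.
  - by case/negP: (valP x); apply/eqP.
  - by case/negP: (valP y); apply/eqP.
  - apply/eqP/negPn/negP=> xy; have /existsPn/(_ y)/negP := one x; apply.
    by rewrite xU yU !andbT; apply/eqP=> xy'; rewrite xy' eqxx in xy.
by rewrite -(card_in_imset pI) leq_wVC // weakly_shattered_proj.
Qed.

End WeakSubstitution.

(** * Families with bounded [wVC] *)

Lemma wVC_le_giso (k : nat) (G H : sgraph) :
  giso G H -> wVC G <= k -> wVC H <= k.
Proof. by move=> GH; apply: leq_trans; apply/wVC_giso/giso_sym. Qed.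

Definition wVC_bounded (k : nat) : graph_family := Family (@wVC_le_giso k).

(** By minimality of the closure, a bound on [wVC] thus passes from a family to its substitution
    closure. *)
Lemma wVC_bounded_subst_closed (k : nat) : subst_closed (wVC_bounded k).
Proof.
move=> F1 v F2 /= k1 k2; apply: leq_trans (wVC_substitution _ _) _.
by rewrite geq_max k1.
Qed.

Lemma NIP_wVC (F : graph_family) :
  NIP F -> exists k : nat, subfamily F (wVC_bounded k).
Proof.
case=> n nF; exists (n.*2 + 7) => G /nF VCn /=; apply: leq_trans (wVC_le G) _.
by rewrite leq_add2r leq_double.
Qed.

Lemma wVC_NIP (F : graph_family) (k : nat) : subfamily F (wVC_bounded k) -> NIP F.
Proof. by move=> kF; exists k => G /kF; apply: leq_trans (VC_le_wVC G). Qed.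

Lemma NIP_subfamily (E F : graph_family) : subfamily E F -> NIP F -> NIP E.
Proof. by move=> EF [n nF]; exists n => G /EF /nF. Qed.

(** * Decomposition of graphs that are not prime *)

Lemma induced_closed_embedding (F : graph_family) (G H : sgraph) (f : H -> G) :
  induced_closed F -> injective f -> {mono f : x y / adj x y} -> F G -> F H.
Proof.
move=> clo fI fM /(clo _ [set f x | x in [set: H]]); apply: family_giso.
apply: giso_sym.
have fP x : f x \in [set f x | x in [set: H]] by rewrite imset_f.
pose g x : induced [set f x | x in [set: H]] := exist _ (f x) (fP x).
exists g => //; apply: inj_card_bij; first by move=> x y [] /fI.
by rewrite card_sig card_imset // cardsT.
Qed.

Lemma induced_closed_substitution (F : graph_family) (F1 : sgraph) (v : F1)
    (F2 : sgraph) : induced_closed F -> 0 < #|F2| ->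
  F (substitution v F2) -> F F1 /\ F F2.
Proof.
move=> clo /card_gt0P[w _] FS; split; last first.
  pose f (y : F2) : substitution v F2 := inr y.
  by apply: (induced_closed_embedding (f := f)) FS => // x y [].
(* The vertex [w] of the copy stands in for the deleted [v]. *)
pose f (x : F1) : substitution v F2 :=
  if insub x is Some u then inl u else inr w.
have fK : cancel f (@subst_proj _ v F2).
  by move=> x; rewrite /f; case: insubP => [u _ //|/negPn/eqP->].
apply: (induced_closed_embedding (f := f)) FS => //; first exact: can_inj fK.
move=> x y; rewrite -{2}(fK x) -{2}(fK y) /f.
by do 2!case: insubP => /= *; rewrite ?adj_irrefl.
Qed.

Lemma card_substitution (F1 : sgraph) (v : F1) (F2 : sgraph) :
  #|substitution v F2| = #|F1|.-1 + #|F2|.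
Proof. by rewrite card_sum card_sig cardC1. Qed.

Lemma primes_bound_wVC (F : graph_family) (k : nat) :
  induced_closed F -> subfamily (primes_of F) (wVC_bounded k) ->
  subfamily F (wVC_bounded k).
Proof.
move=> clo kP G; have [n] := ubnP #|G|; elim: n G => // n IH G ltn FG /=.
(* Assume the bound fails for [G]. Then [G] is prime, as a decomposition would yield the bound by
   induction, and [kP] gives a contradiction. *)
apply/negPn/negP=> nk; case/negP: (nk); apply: kP; split=> //.
case=> [F1 [v [F2 [lt1 lt2 iso]]]]; case/negP: nk.
(* With [F2] empty, [G] would have fewer vertices than [F1], against [lt1]. *)
have F2gt0 : 0 < #|F2|.
  by have := card_giso iso; rewrite card_substitution; lia.
have [FF1 FF2] := induced_closed_substitution clo F2gt0 (family_giso iso FG).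
apply: (wVC_le_giso (giso_sym iso)); apply: wVC_bounded_subst_closed.
  by apply: IH FF1; lia.
by apply: IH FF2; lia.
Qed.

Theorem theorem6p7 :
  (forall F F' : graph_family, eqfamily F (subst_closure F') -> (NIP F <-> NIP F')) /\
  (forall F : graph_family, subst_closed F -> induced_closed F ->
     (NIP F <-> NIP (primes_of F))).
Proof.
split=> [F F' eqF|F _ clo]; split.
- by apply: NIP_subfamily => G F'G; apply/eqF/subfamily_subst_closure.
- case/NIP_wVC=> k kF'; apply: (@wVC_NIP _ k) => G /eqF.
  exact: subst_closure_min kF' (@wVC_bounded_subst_closed k) G.
- by apply: NIP_subfamily => G [].
- by case/NIP_wVC=> k /(primes_bound_wVC clo); exact: wVC_NIP.
Qed.
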